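(* Let $P$ be a program and let $B$ be a set of pattern rules that is correct w.r.t. $P$. Then $\mathit{patunf}(P,B)$ is correct w.r.t. $P$.
   Context: Fix a signature $\Sigma$, a special constant $\mathsf{e}$ (also denoting the empty sequence) and an infinite countable set $X$ of variables, pairwise disjoint. $T(\Sigma,X)$ is the set of terms, $S(\Sigma,X)$ the set of substitutions (maps $X\to T(\Sigma,X)$ moving finitely many variables); composition $x(\sigma\theta)=(x\sigma)\theta$; $\emptyset$ is the identity substitution, $\sigma^0=\emptyset$, $\sigma^{n+1}=\sigma^n\sigma$; $\mathsf{e}\theta=\mathsf{e}$. $\sigma$ commutes with $\theta$ if $x\sigma\theta=x\theta\sigma$ for all $x\in X$. A renaming is a substitution that is a bijection on $X$; $\mathit{mgu}$ is the set of most general unifiers (componentwise on finite sequences). $\mathit{Var}(\sigma)$ is the set of variables in the domain or in the images of the domain. A program is a set of rules $(u,\bar v)$ ($u$ a term, $\bar v$ a finite sequence of terms written $\langle\dots\rangle$); binary rules have $\bar v$ of length $\le1$, written $(u,v)$ with $v\in T(\Sigma,X)\cup\{\mathsf{e}\}$. $[r]$ is the set of renamings of a rule $r$, $[U]=\bigcup_{r\in U}[r]$; $\bar r\ll_S U$ means $\bar r$ is a sequence of elements of $U$ variable disjoint from $S$ and from each other. Let $\mathit{id}$ be the set of rules $(\mathsf{f}(x_1,\dots,x_m),\mathsf{f}(x_1,\dots,x_m))$, $\mathsf{f}\in\Sigma$ of arity $m$, $x_i$ distinct variables. For a set $U$ of binary rules, $T_P^\beta(U)=[\{(u,\mathsf{e})\in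 P\}]\cup[\{(u\theta,v\theta)\mid r=(u,\langle v_1,\dots,v_m\rangle)\in P,\ 1\le i\le m,\ \langle(u_1,\mathsf{e}),\dots,(u_{i-1},\mathsf{e}),(u_i,v)\rangle\ll_r U\cup\mathit{id},\ v\neq\mathsf{e}\text{ if }i<m,\ \theta\in\mathit{mgu}(\langle u_1,\dots,u_i\rangle,\langle v_1,\dots,v_i\rangle)\}]$; $\mathit{binunf}(P)=\bigcup_{n\in\mathbb N}(T_P^\beta)^n(\emptyset)$. A pattern substitution is a pair $(\sigma,\mu)$ of substitutions, with $(\sigma,\mu)(n)=\sigma^n\mu$. A pattern term is $p=(s,(\sigma,\mu))$ with $s\in T(\Sigma,X)\cup\{\mathsf{e}\}$, $p(n)=s\sigma^n\mu$, $\mathit{Var}(p)=\mathit{Var}(s)\cup\mathit{Var}(\sigma)\cup\mathit{Var}(\mu)$; $\widehat{s}=(s,(\emptyset,\emptyset))$. A pattern rule is a pair $r=(p,q)$ of pattern terms, $\mathit{Var}(r)=\mathit{Var}(p)\cup\mathit{Var}(q)$, $\mathit{rules}(r)=\{(p(n),q(n))\mid n\in\mathbb N\}$; it is correct w.r.t. $P$ if $\mathit{rules}(r)\subseteq\mathit{binunf}(P)$, and a set of pattern rules is correct if all its elements are. A pattern substitution $\theta$ is an mgu of two equal-length sequences of pattern terms $\langle p_1,\dots,p_i\rangle,\langle q_1,\dots,q_i\rangle$ if for all $n$, $\theta(n)\in\mathit{mgu}(\langle p_1(n),\dots\rangle,\langle q_1(n),\dots\rangle)$. For a pattern rule $r$,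 $[r]=\{r'\text{ pattern rule}\mid \mathit{rules}(r')\subseteq[\mathit{rules}(r)]\}$ and $[U]=\bigcup_{r\in U}[r]$; $\ll_r$ is extended to pattern rules using the variable sets above. $\mathit{patid}$ is the set of pattern rules $(\widehat{\mathsf{f}(x_1,\dots,x_m)},\widehat{\mathsf{f}(x_1,\dots,x_m)})$, $\mathsf{f}\in\Sigma$ of arity $m$, distinct $x_i$. For sets $B,U$ of pattern rules, $T^\pi_{P,B}(U)=[B]\cup[\{((u,(\sigma,\mu)),(v,(\sigma_i\sigma,\mu_i\mu)))\mid r=(u,\langle v_1,\dots,v_m\rangle)\in P,\ 1\le i\le m,\ \langle(p_1,\widehat{\mathsf{e}}),\dots,(p_{i-1},\widehat{\mathsf{e}}),(p_i,(v,(\sigma_i,\mu_i)))\rangle\ll_r U\cup\mathit{patid},\ v\neq\mathsf{e}\text{ if }i<m,\ (\sigma,\mu)\text{ an mgu of }\langle p_1,\dots,p_i\rangle\text{ and }\langle\widehat{v_1},\dots,\widehat{v_i}\rangle,\ \sigma\text{ commutes with }\sigma_i\text{ and }\mu_i\}]$. The pattern unfolding is $\mathit{patunf}(P,B)=\bigcup_{n\in\mathbb N}(T^\pi_{P,B})^n(\emptyset)$. *)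

(* Defs.v *)
From Stdlib Require List.
From mathcomp Require Import all_boot.
From mathcomp Require Import boolp classical_sets functions cardinality.

Set Implicit Arguments.
Unset Strict Implicit.
Unset Printing Implicit Defensive.

Local Open Scope classical_set_scope.

Record signature := Signature { symbol :> Type; arity : symbol -> nat }.

Inductive term (Sig : signature) (X : Type) : Type :=
| Var (x : X)
| App (f : Sig) (args : {ffun 'I_(arity f) -> term Sig X}).

Arguments Var {Sig X} x.
Arguments App {Sig X} f args.

Section PatternUnfolding.
Context {Sig : signature} {X : Type}.

Local Notation term := (term Sig X).

(* T(Sigma,X) with the additional constant e (here [econst]), encoded as [None]. *)
Definition xterm := option term.
Definition econst : xterm := None.

Fixpoint subst_fun (s : X -> term) (t : term) : term :=
  match t with
  | Var x => s x
  | App f args => App f [ffun i => subst_fun s (args i)]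
  end.

Fixpoint tvars (t : term) : set X :=
  match t with
  | Var x => [set x]
  | App f args => [set y | exists i, tvars (args i) y]
  end.

Definition xvars (t : xterm) : set X := if t is Some t' then tvars t' else set0.

Record substitution := Substitution {
  sfun :> X -> term;
  sfun_fin : finite_set [set x | sfun x <> Var x]
}.

Definition subst (s : substitution) (t : term) : term := subst_fun s t.

Definition xsubst (s : substitution) (t : xterm) : xterm := omap (subst s) t.

Fact sid_fin : finite_set [set x : X | @Var Sig X x <> Var x].
Proof. by apply: (sub_finite_set _ (@finite_set0 X)) => x /=; apply. Qed.

Definition sid : substitution := Substitution sid_fin.

Fact scomp_fin (s t : substitution) :
  finite_set [set x | subst t (s x) <> Var x].
Proof.
apply: (sub_finite_set (B := [set x | s x <> Var x] `|` [set x | t x <> Var x])).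
  move=> x /= stx; have [sx|sx] := pselect (s x = Var x); last by left.
  by right=> tx; apply: stx; rewrite sx.
by rewrite finite_setU; split; apply: sfun_fin.
Qed.

(* Diagrammatic order: [x (s t) = (x s) t]. *)
Definition scomp (s t : substitution) : substitution :=
  Substitution (scomp_fin s t).

Fixpoint spow (s : substitution) (n : nat) : substitution :=
  if n is n'.+1 then scomp (spow s n') s else sid.

Definition commutes (s t : substitution) : Prop :=
  forall x : X, subst t (s x) = subst s (t x).

Definition sdom (s : substitution) : set X := [set x | s x <> Var x].

Definition svars (s : substitution) : set X :=
  sdom s `|` \bigcup_(x in sdom s) tvars (s x).

Definition is_renaming (s : substitution) : Prop :=
  exists2 f : X -> X, bijective f & forall x, s x = Var (f x).

Definition unifier (a b : seq xterm) (s : substitution) : Prop :=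
  map (xsubst s) a = map (xsubst s) b.

Definition more_general (s t : substitution) : Prop :=
  exists d : substitution, forall x, t x = scomp s d x.

Definition mgu (a b : seq xterm) : set substitution :=
  [set s | unifier a b s /\ forall t, unifier a b t -> more_general s t].

Definition rule : Type := (term * seq term)%type.

Definition program : Type := set rule.

Definition rule_vars (r : rule) : set X :=
  tvars r.1 `|` [set x | exists2 t, List.In t r.2 & tvars t x].

(* A binary rule (u, v) is encoded as the pair (Some u, v), where v = e is the
   empty body. Left components are also allowed to be e because the rules
   (p(n), q(n)) of a pattern rule (p, q) may have p(n) = e; [binunf] contains
   no such pair. *)
Definition brule : Type := (xterm * xterm)%type.

Definition brule_vars (r : brule) : set X := xvars r.1 `|` xvars r.2.

Definition renamings (r : brule) : set brule :=
  [set r' | exists2 s, is_renaming s & r' = (xsubst s r.1, xsubst s r.2)].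

Definition renamings_set (U : set brule) : set brule :=
  \bigcup_(r in U) renamings r.

Definition disjoint_vars (V W : set X) : Prop := V `&` W = set0.

(* [ll vars S rs U] stands for rs <<_S U. *)
Definition ll (A : Type) (vars : A -> set X) (S : set X) (rs : seq A)
    (U : set A) : Prop :=
  [/\ List.Forall U rs,
      List.Forall (fun r => disjoint_vars (vars r) S) rs
    & List.ForallOrdPairs (fun r r' => disjoint_vars (vars r) (vars r')) rs].

Definition fapp (f : Sig) (x : 'I_(arity f) -> X) : term :=
  App f [ffun i => Var (x i)].

Definition idrules : set brule :=
  [set r | exists (f : Sig) (x : 'I_(arity f) -> X),
     injective x /\ r = (Some (fapp x), Some (fapp x))].

(* In [Tbeta] and [Tpi], the sequences <u_1, ..., u_i> and <p_1, ..., p_i> are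
   split as [rcons us ui] and [rcons ps pi]. *)
Definition Tbeta (P : program) (U : set brule) : set brule :=
  renamings_set [set r | exists2 u, P (u, [::]) & r = (Some u, econst)]
  `|`
  renamings_set [set r' |
    exists (u : term) (vs : seq term) (i : nat) (us : seq xterm)
           (ui v : xterm) (theta : substitution),
    [/\ P (u, vs),
        0 < i <= size vs /\ size us = i.-1,
        ll brule_vars (rule_vars (u, vs))
           (rcons [seq (w, econst) | w <- us] (ui, v)) (U `|` idrules),
        i < size vs -> v <> econst
      & mgu (rcons us ui) (map Some (take i vs)) theta /\
        r' = (Some (subst theta u), xsubst theta v)]].

Definition binunf (P : program) : set brule :=
  \bigcup_n iter n (Tbeta P) set0.

Definition psubst : Type := (substitution * substitution)%type.

Definition psubst_at (th : psubst) (n : nat) : substitution :=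
  scomp (spow th.1 n) th.2.

Definition pterm : Type := (xterm * psubst)%type.

Definition pterm_at (p : pterm) (n : nat) : xterm :=
  xsubst (psubst_at p.2 n) p.1.

Definition pterm_vars (p : pterm) : set X :=
  xvars p.1 `|` svars p.2.1 `|` svars p.2.2.

Definition hat (s : xterm) : pterm := (s, (sid, sid)).

Definition prule : Type := (pterm * pterm)%type.

Definition prule_vars (r : prule) : set X := pterm_vars r.1 `|` pterm_vars r.2.

Definition rules (r : prule) : set brule :=
  [set b | exists n : nat, b = (pterm_at r.1 n, pterm_at r.2 n)].

Definition correct_rule (P : program) (r : prule) : Prop :=
  rules r `<=` binunf P.

Definition correct (P : program) (R : set prule) : Prop :=
  forall r, R r -> correct_rule P r.

Definition pmgu (ps qs : seq pterm) : set psubst :=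
  [set th | size ps = size qs /\
     forall n, mgu [seq pterm_at p n | p <- ps] [seq pterm_at q n | q <- qs]
                   (psubst_at th n)].

Definition prenamings (r : prule) : set prule :=
  [set r' | rules r' `<=` renamings_set (rules r)].

Definition prenamings_set (U : set prule) : set prule :=
  \bigcup_(r in U) prenamings r.

Definition patid : set prule :=
  [set r | exists (f : Sig) (x : 'I_(arity f) -> X),
     injective x /\ r = (hat (Some (fapp x)), hat (Some (fapp x)))].

Definition Tpi (P : program) (B U : set prule) : set prule :=
  prenamings_set B
  `|`
  prenamings_set [set r' |
    exists (u : term) (vs : seq term) (i : nat) (ps : seq pterm)
           (pi : pterm) (v : xterm) (si mi s m : substitution),
    [/\ P (u, vs),
        0 < i <= size vs /\ size ps = i.-1,
        ll prule_vars (rule_vars (u, vs))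
           (rcons [seq (p, hat econst) | p <- ps] (pi, (v, (si, mi)))) (U `|` patid),
        i < size vs -> v <> econst
      & [/\ pmgu (rcons ps pi) [seq hat (Some w) | w <- take i vs] (s, m),
            commutes s si, commutes s mi
          & r' = ((Some u, (s, m)), (v, (scomp si s, scomp mi m)))]]].

Definition patunf (P : program) (B : set prule) : set prule :=
  \bigcup_n iter n (Tpi P B) set0.

End PatternUnfolding.

Arguments xterm : clear implicits.
Arguments substitution : clear implicits.
Arguments rule : clear implicits.
Arguments program : clear implicits.
Arguments brule : clear implicits.
Arguments psubst : clear implicits.
Arguments pterm : clear implicits.
Arguments prule : clear implicits.

(* Main.v *)
Require Import Defs.
From Stdlib Require List.
From mathcomp Require Import all_boot.
From mathcomp Require Import boolp classical_sets functions cardinality.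

(** Instantiating a pattern unfolding step at [n] gives an ordinary binary
    unfolding step.  The commutation hypotheses yield
    [v (si s)^n mi m = (v si^n mi) (s^n m)], so the [n]-th rule of the new pattern
    rule is [(u th, v(n) th)] where [th = s^n m] is an mgu of the [n]-th instances.
    Instances have no more variables than their pattern, so they stay variable
    disjoint; and only finitely many rules are used, so they all occur in a common
    iterate of [Tbeta].  Renaming is harmless as [binunf] is closed under it. *)

Set Implicit Arguments.
Unset Strict Implicit.
Unset Printing Implicit Defensive.

Local Open Scope classical_set_scope.

Section Terms.
Context {Sig : signature} {X : Type}.

(** Subterms are nested in a finite function; the explicit fixpoint yields an induction hypothesis
    for each argument. *)
Lemma term_args_ind (Q : term Sig X -> Prop) :
  (forall x, Q (Var x)) ->
  (forall (f : Sig) (args : {ffun 'I_(arity f) -> term Sig X}),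
     (forall i, Q (args i)) -> Q (App f args)) ->
  forall t, Q t.
Proof.
move=> QV QA; fix IH 1; case=> [x|f args]; first exact: QV.
by apply: QA => i; apply: IH.
Qed.

Implicit Types (s t d : substitution Sig X) (a : xterm Sig X).

Lemma eq_subst s t : s =1 t -> subst s =1 subst t.
Proof.
move=> st; elim/term_args_ind => [x|f args IH]; first exact: st.
by congr App; apply/ffunP => i; rewrite !ffunE; apply: IH.
Qed.

Lemma subst_sid : subst (@sid Sig X) =1 id.
Proof.
elim/term_args_ind => [//|f args IH].
by congr App; apply/ffunP => i; rewrite !ffunE; apply: IH.
Qed.

Lemma subst_scomp s t u : subst (scomp s t) u = subst t (subst s u).
Proof.
elim/term_args_ind: u => [//|f args IH].
by congr App; apply/ffunP => i; rewrite !ffunE; apply: IH.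
Qed.

Lemma xsubst_sid : xsubst (@sid Sig X) =1 id.
Proof. by case=> [u|//]; rewrite /= subst_sid. Qed.

Lemma xsubst_scomp s t a : xsubst (scomp s t) a = xsubst t (xsubst s a).
Proof. by case: a => [u|//]; rewrite /= subst_scomp. Qed.

Lemma commutes_xsubst s t a :
  commutes s t -> xsubst t (xsubst s a) = xsubst s (xsubst t a).
Proof.
move=> st; case: a => [u|//] /=; rewrite -!subst_scomp.
by congr Some; apply: eq_subst => x; apply: st.
Qed.

Lemma xsubst_spowC s t n a : commutes s t ->
  xsubst t (xsubst (spow s n) a) = xsubst (spow s n) (xsubst t a).
Proof.
move=> st; elim: n => [|n IH] /=; first by rewrite !xsubst_sid.
by rewrite !xsubst_scomp commutes_xsubst // IH.
Qed.

(** In the inductive step the new factor [t] is moved to the left past [s^n], next to [t^n]. *)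
Lemma xsubst_spow_scomp s t n a : commutes s t ->
  xsubst (spow (scomp t s) n) a = xsubst (spow s n) (xsubst (spow t n) a).
Proof.
move=> st; elim: n => [|n IH] /=; first by rewrite !xsubst_sid.
by rewrite !xsubst_scomp IH xsubst_spowC.
Qed.

(** The first commutation splits [(t s)^n] into [t^n s^n]; the second exchanges [s^n] and [d], so
    that [s^n m] is applied last. *)
Lemma pterm_at_scomp a s m t d n : commutes s t -> commutes s d ->
  pterm_at (a, (scomp t s, scomp d m)) n =
  xsubst (psubst_at (s, m) n) (pterm_at (a, (t, d)) n).
Proof.
move=> st sd.
by rewrite /pterm_at /psubst_at /= !xsubst_scomp xsubst_spow_scomp // xsubst_spowC.
Qed.

Lemma pterm_at_hat a n : pterm_at (hat a) n = a.
Proof.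
rewrite /pterm_at xsubst_scomp xsubst_sid.
by elim: n => [|n IH] /=; rewrite ?xsubst_scomp ?IH xsubst_sid.
Qed.

(** The bound keeps even the variables that [s] replaces; in this form it is stable under iterating
    [s], hence uniform in the exponent for powers. *)
Lemma tvars_subst s u : tvars (subst s u) `<=` tvars u `|` svars s.
Proof.
elim/term_args_ind: u => [x y /= sxy|f args IH y /= [i]].
  have [sx|sx] := pselect (s x = Var x); first by left; move: sxy; rewrite /subst /= sx.
  by right; right; exists x.
by rewrite ffunE => /IH[ay|]; [left; exists i|right].
Qed.

Lemma xvars_xsubst s a : xvars (xsubst s a) `<=` xvars a `|` svars s.
Proof. by case: a => [u|y []]; exact: tvars_subst. Qed.

Lemma xvars_xsubst_spow s n a :
  xvars (xsubst (spow s n) a) `<=` xvars a `|` svars s.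
Proof.
elim: n => [|n IH] /= y; first by rewrite xsubst_sid; left.
by rewrite xsubst_scomp => /xvars_xsubst[/IH|]; [|right].
Qed.

Lemma xvars_pterm_at (p : pterm Sig X) n :
  xvars (pterm_at p n) `<=` pterm_vars p.
Proof.
move=> y; rewrite /pterm_at xsubst_scomp.
by move=> /xvars_xsubst[/xvars_xsubst_spow|]; [left|right].
Qed.

Lemma is_renaming_scomp s t :
  is_renaming s -> is_renaming t -> is_renaming (scomp s t).
Proof.
move=> [f bf sf] [g bg tg]; exists (g \o f); first exact: bij_comp.
by move=> x /=; rewrite sf; apply: tg.
Qed.

End Terms.

Section Unfolding.
Context {Sig : signature} {X : Type}.
Implicit Types (P : program Sig X) (U V : set (brule Sig X)).

Definition prule_at (r : prule Sig X) n : brule Sig X :=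
  (pterm_at r.1 n, pterm_at r.2 n).

Lemma prule_at_vars r n : brule_vars (prule_at r n) `<=` prule_vars r.
Proof. by move=> y [] yr; [left|right]; apply: xvars_pterm_at yr. Qed.

(** Disjointness passes to smaller variable sets. It serves to pass from pattern rules to their
    instances, whose membership in [W'] is proved separately. *)
Lemma ll_map (A A' : Type) (vars : A -> set X) (vars' : A' -> set X)
    (g : A -> A') (S : set X) rs (W : set A) (W' : set A') :
  (forall r, vars' (g r) `<=` vars r) ->
  List.Forall (fun r => W' (g r)) rs ->
  ll vars S rs W -> ll vars' S (map g rs) W'.
Proof.
move=> gvars W'rs [_ dS dd].
have disjS (V1 V2 V1' V2' : set X) : V1' `<=` V1 -> V2' `<=` V2 ->
    disjoint_vars V1 V2 -> disjoint_vars V1' V2'.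
  by move=> sub1 sub2 V12; rewrite /disjoint_vars -subset0 => y [/sub1 y1 /sub2 y2]; rewrite -V12.
split; first exact/List.Forall_map.
  apply/List.Forall_map; apply: List.Forall_impl dS => r.
  exact: disjS (gvars r) (@subset_refl _ S).
elim: dd => [|r rs' d _ IH] /=; constructor=> //.
by apply/List.Forall_map; apply: List.Forall_impl d => r'; apply: disjS.
Qed.

Lemma ll_sub (A : Type) (vars : A -> set X) S rs (W W' : set A) :
  W `<=` W' -> ll vars S rs W -> ll vars S rs W'.
Proof.
by move=> WW' [Wrs dS dd]; split=> //; apply: List.Forall_impl Wrs.
Qed.

Lemma Tbeta_mono P U V : U `<=` V -> Tbeta P U `<=` Tbeta P V.
Proof.
move=> UV r [|[r0 r0U rr0]]; [by left|right; exists r0 => //].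
move: r0U => [u [vs [i [us [ui [v [th [Puv szi llU vne mth]]]]]]]].
exists u, vs, i, us, ui, v, th; split=> //.
exact: ll_sub (setSU UV) llU.
Qed.

Lemma iter_Tbeta_le P m n :
  m <= n -> iter m (Tbeta P) set0 `<=` iter n (Tbeta P) set0.
Proof.
elim: m n => [|m IH] n; first by move=> _ r [].
by case: n => // n mn; apply: Tbeta_mono; apply: IH.
Qed.

(** Both halves of [Tbeta] are closed under renaming because renamings compose, so a renamed rule
    appears at the same stage as the original. *)
Lemma binunf_renamings P : renamings_set (binunf P) `<=` binunf P.
Proof.
move=> r [r0 [[|n] _ r0n]] // [s rs ->]; exists n.+1 => //.
have renK (W : set (brule Sig X)) : renamings_set W r0 ->
    renamings_set W (xsubst s r0.1, xsubst s r0.2).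
  move=> [r1 Wr1 [t rt ->]]; exists r1 => //; exists (scomp t s).
    exact: is_renaming_scomp.
  by rewrite !xsubst_scomp.
by case: r0n => /renK; [left|right].
Qed.

(** The iterates increase, so the maximum of the stages of the individual rules serves for the whole
    sequence. *)
Lemma Forall_binunf P V rs :
  List.Forall (binunf P `|` V) rs ->
  exists n, List.Forall (iter n (Tbeta P) set0 `|` V) rs.
Proof.
elim=> [|r rs' rU _ [n IH]]; first by exists 0.
suff [k rk] : exists k, (iter k (Tbeta P) set0 `|` V) r.
  exists (maxn k n); constructor.
    by apply: setSU rk; apply: iter_Tbeta_le; apply: leq_maxl.
  by apply: List.Forall_impl IH; apply/setSU/iter_Tbeta_le/leq_maxr.
by case: rU => [[k _ rk]|rV]; [exists k; left|exists 0; right].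
Qed.

(** A step uses finitely many premises; if they occur by stage [n], its result occurs at stage
    [n.+1]. *)
Lemma Tbeta_binunf P : Tbeta P (binunf P) `<=` binunf P.
Proof.
move=> r [rP|[r0 r0U rr0]]; first by exists 1%N => //; left.
move: r0U => [u [vs [i [us [ui [v [th [Puv szi [llU dS dd] vne mth]]]]]]]].
have [n lln] := Forall_binunf llU.
exists n.+1 => //; right; exists r0 => //.
by exists u, vs, i, us, ui, v, th; split.
Qed.

(** This absorbs the outer closure in both halves of [Tpi], leaving only the unrenamed rules to
    check. *)
Lemma prenamings_correct P r r' :
  correct_rule P r -> prenamings r r' -> correct_rule P r'.
Proof.
move=> cr rr' b /rr'[b0 /cr Pb0 b0b].
by apply: binunf_renamings; exists b0.
Qed.

Lemma prule_at_correct P (U : set (prule Sig X)) r n : correct P U ->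
  (U `|` @patid Sig X) r -> (binunf P `|` @idrules Sig X) (prule_at r n).
Proof.
move=> cU [Ur|[f [x [xI ->]]]]; first by left; apply: cU Ur _ _; exists n.
by right; exists f, x; rewrite /prule_at !pterm_at_hat.
Qed.

Lemma Tpi_correct P (B U : set (prule Sig X)) :
  correct P B -> correct P U -> correct P (Tpi P B U).
Proof.
move=> cB cU r [[r0 /cB cr0]|[r0 r0U]]; first exact: prenamings_correct.
apply: prenamings_correct => b [n ->].
move: r0U => [u [vs [i [ps [pi [v [si [mi [s [m]]]]]]]]]].
move=> [Puv [i_bd szps] llU vne [[_ pth] ssi smi ->]] /=.
(* The ordinary step with mgu [s^n m] gives exactly this pair, which is then renamed by the
   identity. *)
apply: Tbeta_binunf; right; exists (Some (subst (psubst_at (s, m) n) u),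
  xsubst (psubst_at (s, m) n) (pterm_at (v, (si, mi)) n)); last first.
  exists (@sid Sig X); last by rewrite !xsubst_sid pterm_at_scomp.
  by exists id => //; exists id.
exists u, vs, i, [seq pterm_at p n | p <- ps], (pterm_at pi n),
  (pterm_at (v, (si, mi)) n), (psubst_at (s, m) n); split=> //.
- by rewrite size_map.
- have [Urs _ _] := llU.
  (* Instantiating at [n] turns each premise [(p, hat econst)] into [(p(n), econst)], as [Tbeta]
     requires. *)
  have := ll_map (prule_at_vars ^~ n) _ llU.
  rewrite map_rcons -!map_comp.
  rewrite (eq_map (g := (fun w => (w, econst)) \o (fun p => pterm_at p n))).
    apply; apply: List.Forall_impl Urs => r'; exact: prule_at_correct.
  by move=> p; rewrite /= /prule_at /= pterm_at_hat.
(* A substitution sends only [econst] to [econst], so a nonempty body stays nonempty in every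
   instance. *)
- by move=> /vne; case: (v).
- split=> //; have := pth n; rewrite map_rcons -map_comp.
  by rewrite (eq_map (g := Some)) // => w; rewrite /= pterm_at_hat.
Qed.

End Unfolding.

Theorem theorem3p12 (Sig : signature) (X : Type)
    (X_countable : countable [set: X]%classic)
    (X_infinite : infinite_set [set: X]%classic)
    (P : program Sig X) (B : set (prule Sig X)) :
  correct P B -> correct P (patunf P B).
Proof.
move=> cB r [n _]; elim: n r => [//|n IH] r.
exact: Tpi_correct cB IH r.
Qed.
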